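(* Let $m$ be a positive integer, let $\mathcal{C}_m$ be the Shi arrangement of type C, and fix $i$ and $j$ with $1\leq i<j\leq m$. Put $T:=q-2m$. Then for all sufficiently large positive integers $q$: \begin{align*} \left|M\big((\mathcal{C}_m^{\{2x_i=0\}})_q\big)\right|&= \begin{cases} T^{m-i}(T+1)^{i-1}&\text{if $q$ is odd},\\ 2T^{m-i}(T+1)^{i-1} &\text{if $q$ is even}; \end{cases} \\ \left|M\big((\mathcal{C}_m^{\{2x_i=1\}})_q\big)\right|&= \begin{cases} T^{i-1}(T+1)^{m-i}&\text{if $q$ is odd},\\ 0 &\text{if $q$ is even}; \end{cases} \\ \left|M\big((\mathcal{C}_m^{\{x_i - x_j=0\}})_q\big)\right|&=(T+1)^{j-i-1}(T+2)^{m-j+i};\\ \left|M\big((\mathcal{C}_m^{\{x_i - x_j=1\}})_q\big)\right|&=T^{m-j+i}(T+1)^{j-i-1};\\ \left|M\big((\mathcal{C}_m^{\{x_i + x_j=0\}})_q\big)\right|&= \begin{cases} T^{m-j}(T+1)^{j-i}(T+2)^{i-1} &\text{if $q$ is odd},\\ T^{m-j}(T+1)^{j-i-1}(T+2)^i &\text{if $q$ is even}; \end{cases} \\ \left|M\big((\mathcal{C}_m^{\{x_i + x_j=1\}})_q\big)\right|&= \begin{cases} T^{i-1}(T+1)^{j-i}(T+2)^{m-j} &\text{if $q$ is odd},\\ T^i(T+1)^{j-i-1}(T+2)^{m-j} &\text{if $q$ is even}. \end{cases} \end{align*}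
   Context: For $q\in\mathbb{Z}_{>0}$ put $\mathbb{Z}_q=\mathbb{Z}/q\mathbb{Z}$. A hyperplane $H$ given by an integral equation $a_1x_1+\cdots+a_mx_m=b$ ($a_k,b\in\mathbb{Z}$) defines $H[q]=\{x\in\mathbb{Z}_q^m \mid a_1x_1+\cdots+a_mx_m= b \text{ in } \mathbb{Z}_q\}$, using the equation exactly as written (so $\{2x_i=0\}$ is not replaced by $\{x_i=0\}$). For a finite set $\mathcal{A}$ of such hyperplanes and $H\in\mathcal{A}$, $\mathcal{A}^H$ denotes the restriction of $\mathcal{A}$ to $H$, and the complement of the restriction modulo $q$ is $$M((\mathcal{A}^H)_q)=H[q]\setminus\bigcup_{K\in\mathcal{A},\,K\neq H}K[q],$$ i.e. the set of points of $H[q]\subseteq\mathbb{Z}_q^m$ lying on no other hyperplane of $\mathcal{A}$ modulo $q$. The Shi arrangement of type C is $\mathcal{C}_m=\{\{2x_i=0\},\{2x_i=1\}\mid 1\le i\le m\}\cup\{\{x_i\pm x_j=0\},\{x_i\pm x_j=1\}\mid 1\leq i<j\leq m\}$. ''For all sufficiently large $q$'' means: there is $q_0$ such that the statement holds for every integer $q\ge q_0$. *)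

(* Defs.v *)
From mathcomp Require Import all_boot all_order all_algebra.

Set Implicit Arguments.
Unset Strict Implicit.
Unset Printing Implicit Defensive.

Import GRing.Theory.
Local Open Scope ring_scope.

(* (a, b) stands for the equation a_1 x_1 + ... + a_m x_m = b; equations are
   never normalized, since reduction modulo q depends on the equation as
   written. *)
Definition hyperplane (m : nat) : Type := ('rV[int]_m * int)%type.

(* 'Z_q is Z/qZ only for q > 1. *)
Definition hyp_mod (m q : nat) (H : hyperplane m) : {set 'rV['Z_q]_m} :=
  [set x : 'rV['Z_q]_m | \sum_(k < m) (H.1 0 k)%:~R * x 0 k == H.2%:~R].

(* The complement of the restriction of A to H, modulo q. Here K != H compares
   equations; this amounts to comparing hyperplanes as long as different
   equations in A define different hyperplanes, as is the case for
   [shi_typeC]. *)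
Definition restr_compl (m q : nat) (A : seq (hyperplane m))
    (H : hyperplane m) : {set 'rV['Z_q]_m} :=
  hyp_mod q H :\: \bigcup_(K <- A | K != H) hyp_mod q K.

Definition hyp_double (m : nat) (i : 'I_m) (b : int) : hyperplane m :=
  (2 *: delta_mx 0 i, b).

Definition hyp_sub (m : nat) (i j : 'I_m) (b : int) : hyperplane m :=
  (delta_mx 0 i - delta_mx 0 j, b).

Definition hyp_add (m : nat) (i j : 'I_m) (b : int) : hyperplane m :=
  (delta_mx 0 i + delta_mx 0 j, b).

Definition shi_typeC (m : nat) : seq (hyperplane m) :=
  let pairs := [seq p : 'I_m * 'I_m <- enum {: 'I_m * 'I_m} | (p.1 < p.2)%N] in
  [seq hyp_double i b | i <- enum 'I_m, b <- [:: 0; 1]]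
  ++ [seq hyp_sub p.1 p.2 b | p <- pairs, b <- [:: 0; 1]]
  ++ [seq hyp_add p.1 p.2 b | p <- pairs, b <- [:: 0; 1]].

(* Main.v *)
Require Import Defs.
From mathcomp Require Import all_boot all_order all_algebra.
From mathcomp Require Import zify ring.

Set Implicit Arguments.
Unset Strict Implicit.
Unset Printing Implicit Defensive.

Import GRing.Theory.

(** Put x_(-k) = - x_k and order the 2m signed labels by
    1 < 2 < ... < m < -m < ... < -2 < -1. Since x_a - x_b = x_(-b) - x_(-a), the
    equations of the arrangement are exactly the equations x_a - x_b = 0 and
    x_a - x_b = 1 for signed labels a < b, each written twice (once for (a, b) and
    once for its mirror image (-b, -a)) unless b = -a. So a point of the complement
    of the restriction to H is a placement of the signed labels on the circle Z_q,
    symmetric under x |-> -x, in which labels increase along every run of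
    consecutive occupied cells, except that the pair (a0, b0) defining H, together
    with its mirror image, does satisfy its equation: the two labels share a cell
    (x_a0 = x_b0), or they are adjacent in decreasing order (x_a0 = x_b0 + 1).

    Let k be an index that H does not involve. Erasing k and -k deletes two opposite
    cells, and leaves such a placement on Z_(q-2) together with the slot (a pair of
    consecutive cells) that received k. Conversely k fits in a slot (c, c+1) when the
    labels in c are below k and those in c+1 are above k ([valid_of_slot],
    [slot_of_valid]). The number of slots fit for k does not depend on the placement
    ([card_slots]). Let X be the set of cells with a label above k, and Y the set of
    cells whose successor has a label below k; the bad slots are X union Y. If the
    labels occupied distinct cells and the runs were increasing, X and Y would be
    disjoint and have as many elements in total as there are occupied cells, so the
    number of good slots would be the number of empty cells. When H says x_a0 = x_b0,
    each special pair saves an occupied cell, unless it has k strictly between its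
    labels, in which case its cell counts once for X and once for Y. When H says
    x_a0 = x_b0 + 1, each special pair with k strictly between puts one slot in both
    X and Y. With T = q - 2 (number of placed indices), a quantity that insertion
    preserves, this gives T + #pairs - #crossed pairs, respectively
    T + #crossed pairs.

    By induction the count is a product of these factors times the number of
    placements of the special labels alone ([card_configs_setT]). For those, the
    positions are determined by a single residue t, subject to conditions
    2t <> 0, 1, ...; the number of solutions depends on the parity of q. *)

(** * Deleting two opposite cells of a circle *)

(** Cells of the circle Z_q are the naturals below q; [oppc] and [nextc] are the
    opposite and the successor modulo q. *)
Definition oppc (q t : nat) := if t == 0 then 0 else q - t.
Definition nextc (q t : nat) := if t.+1 == q then 0 else t.+1.

(** Inserting a pair of opposite cells in Z_q, one of them just after the cell c,
    gives Z_(q+2): the cell inserted after c becomes [new_cell q c], and the old cell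
    t becomes [widenc q c t]. The lower of the two new cells is [low_cell q c]; when c
    is in the upper half of the circle, this is the opposite of the cell inserted
    after c. In the middle slot of an odd circle both new cells come after c, the one
    named by c first. *)
Definition new_cell (q c : nat) := if c.*2 < q then c.+1 else c.+2.
Definition low_cell (q c : nat) := if c.*2 < q then c.+1 else q - c.
Definition widenc (q c t : nat) :=
  t + (low_cell q c <= t) + (q.+1 - low_cell q c <= t).

(* All facts about these functions are linear arithmetic, once the conditionals
   are split from the inside out. *)
Ltac cell_lia :=
  rewrite /widenc /low_cell /new_cell /oppc /nextc;
  repeat (match goal with |- context [if ?b then _ else _] =>
    lazymatch b with
    | context [if _ then _ else _] => fail
    | _ => let E := fresh in case E: b
    end end); lia.

Lemma oppc_lt q t : t < q -> oppc q t < q.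
Proof. cell_lia. Qed.
Lemma nextc_lt q t : t < q -> nextc q t < q.
Proof. cell_lia. Qed.
Lemma oppcK q t : t < q -> oppc q (oppc q t) = t.
Proof. cell_lia. Qed.
Lemma nextc_inj q t u : t < q -> u < q -> nextc q t = nextc q u -> t = u.
Proof. cell_lia. Qed.
Lemma nextc_oppc q t u : t < q -> u < q ->
  (oppc q u == nextc q (oppc q t)) = (t == nextc q u).
Proof. cell_lia. Qed.

Section Cells.
Variables (q c : nat).
Hypothesis cq : c < q.
Notation p := (new_cell q c).

Lemma new_cell_lt : p < q.+2.
Proof. cell_lia. Qed.
Lemma widenc_lt t : t < q -> widenc q c t < q.+2.
Proof. cell_lia. Qed.
Lemma widenc_oppc t : t < q -> widenc q c (oppc q t) = oppc q.+2 (widenc q c t).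
Proof. cell_lia. Qed.
Lemma widenc_inj t u : t < q -> u < q -> widenc q c t = widenc q c u -> t = u.
Proof. cell_lia. Qed.
Lemma widenc_new t : t < q -> widenc q c t <> p.
Proof. cell_lia. Qed.
Lemma nextc_widenc_new t : t < q -> (nextc q.+2 (widenc q c t) == p) = (t == c).
Proof. cell_lia. Qed.
Lemma widenc_nextc_new t : t < q ->
  (widenc q c t == nextc q.+2 p) -> (t == nextc q c).
Proof. cell_lia. Qed.
(** The exception is the middle slot of an odd circle, where the cell after the new
    one is its opposite, also new. *)
Lemma widenc_next_new t : t < q -> t == nextc q c ->
  (widenc q c t == nextc q.+2 p) || (t == oppc q c).
Proof. cell_lia. Qed.
(** Old neighbours stay neighbours unless one of the two insertions, after c or
    before the opposite of c, separates them. *)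
Lemma widenc_nextc t u : t < q -> u < q ->
  (widenc q c u == nextc q.+2 (widenc q c t))
  = (u == nextc q t) && (t != c) && (u != oppc q c).
Proof. 
move=> tq uq.
cell_lia. Qed.
Lemma widenc_surj s : s < q.+2 -> s <> p -> s <> oppc q.+2 p ->
  exists2 t, t < q & widenc q c t = s.
Proof.
move=> sq sp snp.
exists (s - (low_cell q c < s) - (q.+2 - low_cell q c < s)); move: sp snp; cell_lia.
Qed.
Lemma new_cell_oppc : p != oppc q.+2 p.
Proof. cell_lia. Qed.
Lemma new_cell_nextc_oppc : p != nextc q.+2 (oppc q.+2 p).
Proof. cell_lia. Qed.
End Cells.

Lemma new_cell_inj q c d : c < q -> d < q -> new_cell q c = new_cell q d -> c = d.
Proof. cell_lia. Qed.
(** The cells p that arise by insertion are those with 2p <> 0 and 2p <> 1, which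
    are exactly the conditions that the arrangement puts on a single coordinate. *)
Lemma new_cell_surj q p : p < q.+2 -> p != oppc q.+2 p -> p != nextc q.+2 (oppc q.+2 p) ->
  exists2 c, c < q & new_cell q c = p.
Proof.
move=> pq p1 p2; exists (if p.*2 < q.+2 then p.-1 else p - 2); move: p1 p2; cell_lia.
Qed.

(** * Signed labels and configurations *)

Section Labels.
Variable m : nat.
(** (k, false) stands for the label k and (k, true) for -k. *)
Definition label : Type := ('I_m * bool)%type.
Implicit Types a b : label.

Definition mirror a : label := (a.1, ~~ a.2).
Definition rank a : nat := if a.2 then m.*2.-1 - a.1 else a.1.

Lemma mirrorK : involutive mirror.
Proof. by case=> k s; rewrite /mirror /= negbK. Qed.

Lemma rank_inj : injective rank.
Proof.
move=> [k s] [l t]; rewrite /rank /= => E.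
have kl : k = l by apply: val_inj => /=; move: E (ltn_ord k) (ltn_ord l); case: s; case: t; lia.
by subst l; congr pair; move: E (ltn_ord k); case: s; case: t => //; lia.
Qed.

Lemma ltn_rank_mirror a b : (rank (mirror a) < rank (mirror b)) = (rank b < rank a).
Proof.
case: a b => [k s] [l t]; rewrite /rank /mirror /=.
by move: (ltn_ord k) (ltn_ord l); case: s; case: t => /=; lia.
Qed.

Lemma ltn_rank_mirrorl a b : (rank (mirror a) < rank b) = (rank (mirror b) < rank a).
Proof. by rewrite -{1}(mirrorK b) ltn_rank_mirror. Qed.

Lemma ltn_rank_mirrorr a b : (rank a < rank (mirror b)) = (rank b < rank (mirror a)).
Proof. by rewrite -{1}(mirrorK a) ltn_rank_mirror. Qed.

Lemma mirror_neq a : mirror a != a.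
Proof. by case: a => k s; rewrite /mirror xpair_eqE /=; case: s; rewrite ?andbF. Qed.

Definition place q (y : {ffun 'I_m -> 'I_q}) a : nat :=
  if a.2 then oppc q (y a.1) else y a.1.

Lemma place_lt q (y : {ffun 'I_m -> 'I_q}) a : place y a < q.
Proof. by rewrite /place; case: a.2 => //; apply: oppc_lt. Qed.

Lemma place_mirror q (y : {ffun 'I_m -> 'I_q}) a : place y (mirror a) = oppc q (place y a).
Proof. by case: a => k [] //; rewrite /place /= oppcK. Qed.

Definition meets q (y : {ffun 'I_m -> 'I_q}) a b (e : bool) : bool :=
  place y a == (if e then nextc q (place y b) else place y b).

(** The equation of (a, b) and that of its mirror image are the same. *)
Lemma meets_mirror q (y : {ffun 'I_m -> 'I_q}) a b e :
  meets y (mirror b) (mirror a) e = meets y a b e.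
Proof.
rewrite /meets !place_mirror; case: e; first by rewrite nextc_oppc ?place_lt.
apply/eqP/eqP => [E|->//].
by rewrite -(oppcK (place_lt y a)) -E oppcK ?place_lt.
Qed.

Section Pair.
Variables (a0 b0 : label) (eps : bool).
Hypothesis lt_ab0 : rank a0 < rank b0.

(** The pair (a0, b0), with the right-hand side [eps], is the hyperplane H of the
    restriction. It has two names, which coincide when H is 2 x_i = 0 or 2 x_i = 1. *)
Definition special a b : bool :=
  ((a == a0) && (b == b0)) || ((a == mirror b0) && (b == mirror a0)).

Lemma special_mirror a b : special (mirror b) (mirror a) = special a b.
Proof.
rewrite /special !(can2_eq mirrorK mirrorK) !mirrorK orbC.
by congr orb; rewrite andbC.
Qed.

Lemma special_lt a b : special a b -> rank a < rank b.
Proof. by case/orP => /andP[/eqP-> /eqP->] //; rewrite ltn_rank_mirror. Qed.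

Lemma special_fst_snd a b c : special a b -> special b c -> False.
Proof.
move=> s1 s2; have l1 := special_lt s1; have l2 := special_lt s2.
case/orP: s1 s2 => /andP[/eqP E1 /eqP E2]; subst a b => /orP[]/andP[/eqP E /eqP E3]; subst c.
- by move: lt_ab0; rewrite E ltnn.
- by have := mirror_neq b0; rewrite -E eqxx.
- by have := mirror_neq a0; rewrite E eqxx.
- by move: l1; rewrite E ltnn.
Qed.

(** The point y lies on H and on no other hyperplane, as far as the coordinates in S
    are concerned. *)
Definition valid q (S : {set 'I_m}) (y : {ffun 'I_m -> 'I_q}) : Prop :=
  forall a b e, a.1 \in S -> b.1 \in S -> rank a < rank b ->
    meets y a b e = (e == eps) && special a b.

(** Coordinates outside S are pinned to 0, so that this set counts the placements of
    the labels in S. *)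
Definition configs q (S : {set 'I_m}) : {set {ffun 'I_m -> 'I_q}} :=
  [set y : {ffun 'I_m -> 'I_q} | [forall a, forall b, forall e,
     [&& a.1 \in S, b.1 \in S & rank a < rank b] ==>
     (meets y a b e == (e == eps) && special a b)]
   & [forall k, (k \notin S) ==> (y k == 0 :> nat)]].

Lemma configsP q (S : {set 'I_m}) (y : {ffun 'I_m -> 'I_q}) :
  reflect (valid S y /\ forall k, k \notin S -> y k = 0 :> nat) (y \in configs q S).
Proof.
rewrite inE; apply: (iffP andP) => [[/forallP V /forallP Z]|[V Z]]; split.
- move=> a b e aS bS ab; move/forallP: (V a) => /(_ b)/forallP/(_ e).
  by rewrite aS bS ab /= => /eqP.
- by move=> k kS; apply/eqP; move/implyP: (Z k); apply.
- apply/forallP=> a; apply/forallP=> b; apply/forallP=> e; apply/implyP.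
  by case/and3P=> aS bS ab; apply/eqP; apply: V.
- by apply/forallP => k; apply/implyP => /Z ->.
Qed.

(** The label k may be inserted between the cells c and c + 1. By symmetry, -k then
    fits in the opposite slot. *)
Definition slot q (S : {set 'I_m}) (y : {ffun 'I_m -> 'I_q}) (k : 'I_m) (c : nat) : bool :=
  [forall a : label, (a.1 \in S) ==>
     ((place y a == c) ==> (rank a < k)) && ((place y a == nextc q c) ==> (k < rank a))].

Lemma slotP q (S : {set 'I_m}) (y : {ffun 'I_m -> 'I_q}) (k : 'I_m) c :
  reflect (forall a : label, a.1 \in S ->
     (place y a = c -> rank a < k) /\ (place y a = nextc q c -> k < rank a)) (slot S y k c).
Proof.
apply: (iffP forallP) => H a.
  by move=> aS; move: (H a); rewrite aS /= => /andP[/implyP H1 /implyP H2]; split=> /eqP.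
by apply/implyP => /H[H1 H2]; apply/andP; split; apply/implyP => /eqP.
Qed.

Section Insertion.
Variables (q : nat) (S : {set 'I_m}) (k : 'I_m).
Hypotheses (kS : k \notin S) (a0S : a0.1 \in S) (b0S : b0.1 \in S).

Lemma special_supp a b : special a b -> (a.1 \in S) && (b.1 \in S).
Proof. by case/orP => /andP[/eqP-> /eqP->]; rewrite /= a0S b0S. Qed.

Lemma special_notin a b :
  (a.1 == k) || (b.1 == k) -> special a b = false.
Proof.
move=> Hk; apply/negP => /special_supp/andP[aS bS].
by case/orP: Hk => /eqP E; move: kS; rewrite -E ?aS ?bS.
Qed.

Lemma rank_notin a : a.1 \in S -> rank a != k.
Proof.
move=> aS; apply/eqP => E; have /(congr1 fst) /= ak := @rank_inj a (k, false) E.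
by move: kS; rewrite -ak aS.
Qed.

Section Related.
Variables (y : {ffun 'I_m -> 'I_q}) (c : 'I_q) (x : {ffun 'I_m -> 'I_q.+2}).
Hypothesis xk : x k = new_cell q c :> nat.
Hypothesis xS : forall l, l != k -> x l = widenc q c (y l) :> nat.

Lemma place_widenc a : a.1 \in S -> place x a = widenc q c (place y a).
Proof.
case: a => l s /= lS; have lk : l != k by apply: contraNneq kS => <-.
by rewrite /place /=; case: s; rewrite xS // widenc_oppc.
Qed.

Notation kp := ((k, false) : label).
Lemma place_new : place x kp = new_cell q c.
Proof. exact: xk. Qed.

(** Insertion in a slot for k never separates labels a < b with x_a = x_b + 1: this
    would need b < k < a. So it creates and destroys no equation between old labels. *)
Lemma meets_widenc a b e : a.1 \in S -> b.1 \in S -> rank a < rank b ->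
  slot S y k c -> meets x a b e = meets y a b e.
Proof.
move=> aS bS ab /slotP sl; rewrite /meets !place_widenc //.
case: e; last first.
  by apply/eqP/eqP => [/widenc_inj|->//]; apply; rewrite ?place_lt.
rewrite widenc_nextc ?place_lt //.
case: (place y a =P _) => //= E.
apply/andP; split; apply/eqP => E2.
  have [/(_ E2) l1 _] := sl _ bS; have [_ l2] := sl _ aS.
  by move: (l2 (etrans E (congr1 _ E2))) => ?; lia.
have Ea : place y (mirror a) = c by rewrite place_mirror E2 oppcK.
have Eb : place y (mirror b) = nextc q c.
  apply/eqP; move/eqP: E; rewrite -(nextc_oppc (place_lt y a) (place_lt y b)) -!place_mirror.
  by rewrite Ea.
have [/(_ Ea) l1 _] := sl (mirror a) aS; have [_ /(_ Eb) l2] := sl (mirror b) bS.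
move: (ltn_rank_mirror a b); lia.
Qed.

(** Up to mirroring, an equation that involves k has the form (k, b), (b, k) or
    (k, -k). *)
Lemma valid_of_slot : valid S y -> slot S y k c -> valid (k |: S) x.
Proof.
move=> V sl.
have key b e : b.1 \in S -> (rank kp < rank b -> ~~ meets x kp b e)
     /\ (rank b < rank kp -> ~~ meets x b kp e).
  move=> bS; have [s1 s2] := slotP _ _ _ _ sl _ bS.
  rewrite /meets (place_widenc bS) place_new.
  have nq := @widenc_new _ c (ltn_ord c) _ (place_lt y b).
  split=> l; case: e; apply/eqP => E; try by (case: nq; rewrite E).
    move/esym/eqP: E; rewrite nextc_widenc_new ?place_lt // => /eqP /s1.
    by rewrite /rank /= in l *; lia.
  move/eqP: E => /widenc_nextc_new; rewrite place_lt => /(_ (ltn_ord _) isT)/eqP/s2.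
  by rewrite /rank /= in l *; lia.
move=> a b e; rewrite !inE => /orP[/eqP ak|aS] /orP[/eqP bk|bS] ab; last first.
- by rewrite (meets_widenc _ aS) // V.
- rewrite (@special_notin a b) ?bk ?eqxx ?orbT // andbF; apply/negbTE.
  case: b bk ab => l [] /= -> ab; last by case: (key a e aS) => _; apply.
  rewrite -meets_mirror; case: (key (mirror a) e aS) => + _; apply.
  by rewrite ltn_rank_mirrorr.
- rewrite (@special_notin a b) ?ak ?eqxx ?orbT // andbF; apply/negbTE.
  case: a ak ab => l [] /= -> ab; last by case: (key b e bS) => + _; apply.
  rewrite -meets_mirror; case: (key (mirror b) e bS) => _; apply.
  by rewrite ltn_rank_mirrorl.
rewrite (@special_notin a b) ?ak ?eqxx ?orbT // andbF.
have -> : a = kp.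
  case: a ak ab => l [] /= -> //; case: b bk => l' [] /= ->;
    rewrite /rank /=; have := ltn_ord k; lia.
have -> : b = mirror kp.
  case: b bk ab => l [] /= -> //; case: a ak => l' [] /= ->;
    rewrite /rank /=; have := ltn_ord k; lia.
rewrite /meets place_mirror place_new; apply/negbTE; case: e.
  exact: new_cell_nextc_oppc.
exact: new_cell_oppc.
Qed.

Lemma slot_of_valid : valid (k |: S) x -> valid S y /\ slot S y k c.
Proof.
move=> V.
have inS l : l \in S -> l \in k |: S by move=> lS; rewrite !inE lS orbT.
have kpS : kp.1 \in k |: S by rewrite !inE eqxx.
have sl1 a : a.1 \in S -> place y a = c -> rank a < k.
  move=> aS E; rewrite ltnNge; apply/negP => le.
  have lt : rank kp < rank a by rewrite ltn_neqAle eq_sym rank_notin.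
  have := V _ _ true kpS (inS _ aS) lt; rewrite special_notin ?eqxx // andbF /meets.
  by rewrite (place_widenc aS) E place_new eq_sym nextc_widenc_new // eqxx.
have sl : slot S y k c.
  apply/slotP=> a aS; split; first exact: sl1.
  move=> E; rewrite ltnNge; apply/negP => le.
  have lt : rank a < rank kp by rewrite ltn_neqAle rank_notin.
  (* In the middle slot, c + 1 is the opposite of c, so the mirror of a lies in c. *)
  case/orP: (widenc_next_new (ltn_ord c) (place_lt y a) (introT eqP E)) => /eqP E2.
    have := V _ _ true (inS _ aS) kpS lt; rewrite special_notin ?eqxx ?orbT // andbF /meets.
    by rewrite (place_widenc aS) E2 place_new eqxx.
  have := sl1 (mirror a) aS; rewrite place_mirror E2 oppcK // => /(_ erefl).
  case: a {aS E E2} lt le => l []; rewrite /rank /=; have := ltn_ord l; have := ltn_ord k; lia.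
split=> // a b e aS bS ab.
by rewrite -(meets_widenc _ aS bS ab sl) V ?inS.
Qed.
End Related.
End Insertion.

(** * Counting the slots *)

(** Each special pair is determined by its larger label, which is how special pairs
    are counted below. *)
Lemma card_special (Q : rel label) :
  #|[set b | [exists a, special a b && Q a b]]|
  = Q a0 b0 + (b0 != mirror a0) * Q (mirror b0) (mirror a0).
Proof.
set X := [set b | _].
have -> : X = [set b in nseq (Q a0 b0) b0
                 ++ nseq ((b0 != mirror a0) && Q (mirror b0) (mirror a0)) (mirror a0)].
  apply/setP=> b; rewrite !inE mem_cat !mem_nseq !lt0b.
  apply/existsP/orP => [[a /andP[/orP[]/andP[/eqP-> /eqP->] Qab]]|].
  - by left; rewrite Qab eqxx.
  - case: (eqVneq b0 (mirror a0)) => [E|_]; last by right; rewrite /= Qab eqxx.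
    by left; move: Qab; rewrite -{2}(mirrorK a0) -E ?andbT.
  - case=> [/andP[Qab /eqP->]|/andP[/andP[_ Qab] /eqP->]].
      by exists a0; rewrite /special !eqxx.
    by exists (mirror b0); rewrite /special !eqxx orbT.
rewrite cardsE (card_uniqP _) ?size_cat ?size_nseq ?mulnb //.
case: (Q a0 b0); case: eqVneq; case: (Q (mirror b0) _) => //= ne.
by rewrite inE ne.
Qed.

Definition crossings (k : nat) : nat :=
  (rank a0 < k < rank b0)
  + (b0 != mirror a0) * (rank (mirror b0) < k < rank (mirror a0)).
Definition npairs : nat := 1 + (b0 != mirror a0).

Section Slots.
Variables (q : nat) (S : {set 'I_m}) (k : 'I_m) (y : {ffun 'I_m -> 'I_q}).
Hypotheses (kS : k \notin S) (a0S : a0.1 \in S) (b0S : b0.1 \in S).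
Hypothesis Vy : valid S y.

Definition cell a : 'I_q := Ordinal (place_lt y a).

Lemma cell_collision (a b : label) : a.1 \in S -> b.1 \in S -> rank a < rank b ->
  (cell a == cell b) = ~~ eps && special a b.
Proof.
by move=> aS bS ab; rewrite -(Vy false aS bS ab).
Qed.

(** Labels of W share a cell only as a special pair with right-hand side 0, and the
    larger label of a special pair is never the smaller one of a special pair; so
    dropping the larger label of every special pair makes [cell] injective without
    changing its image. *)
Lemma card_cells (W : {set label}) : (forall a, a \in W -> a.1 \in S) ->
  #|cell @: W| + ~~ eps * #|[set b | [exists a, special a b && ((a \in W) && (b \in W))]]|
  = #|W|.
Proof.
move=> WS; set R := [set b | _].
pose R' := if eps then set0 else R.
have -> : ~~ eps * #|R| = #|R'|.
  by rewrite /R'; case: (eps); rewrite ?cards0 ?mul0n ?mul1n.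
have sR : R' \subset W.
  rewrite /R'; case: (eps); first exact: sub0set.
  by apply/subsetP => b; rewrite inE => /existsP[a /and3P[]].
have -> : cell @: W = cell @: (W :\: R').
  apply/eqP; rewrite eqEsubset [X in _ && X]imsetS ?subsetDl // andbT.
  apply/subsetP=> c /imsetP[b bW ->].
  case bR: (b \in R'); last by apply: imset_f; rewrite inE bR bW.
  move: (bR); rewrite {1}/R'; case: ifP => [_|e0]; first by rewrite inE.
  rewrite inE => /existsP[a /and3P[sab aW _]].
  have -> : cell b = cell a.
    by apply/esym/eqP; rewrite cell_collision ?WS ?e0 ?special_lt.
  apply: imset_f; rewrite in_setD aW andbT /R' ?e0 inE; apply/negP=> /existsP[a' /and3P[s' _ _]].
  exact: (special_fst_snd s' sab).
rewrite card_in_imset ?cardsD; first by rewrite (setIidPr sR) subnK ?subset_leq_card.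
have key a b : a \in W :\: R' -> b \in W :\: R' -> rank a < rank b -> cell a == cell b -> False.
  rewrite !in_setD => /andP[_ aW] /andP[bR bW] ab.
  rewrite cell_collision ?WS // => /andP[ne s]; move: bR; rewrite /R' (negbTE ne) inE.
  by case/existsP; exists a; rewrite s aW.
move=> a b aW bW E; case: (ltngtP (rank a) (rank b)) => [l|l|/rank_inj//].
  by case: (key a b) => //; apply/eqP.
by case: (key b a) => //; apply/eqP.
Qed.

Let above : {set label} := [set a : label | (a.1 \in S) && (k < rank a)].
Let below : {set label} := [set a : label | (a.1 \in S) && (rank a < k)].
Definition next_cell (c : 'I_q) : 'I_q := Ordinal (nextc_lt (ltn_ord c)).

Lemma next_cell_inj : injective next_cell.
Proof. by move=> c d [] /nextc_inj E; apply/val_inj/E. Qed.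

Lemma card_above_below : #|above| + #|below| = #|S|.*2.
Proof.
rewrite -cardsUI; have -> : above :&: below = set0.
  by apply/setP=> a; rewrite !inE; apply/negP; lia.
have -> : above :|: below = setX S [set: bool].
  apply/setP=> -[l s]; rewrite !inE /= andbT -andb_orr.
  case lS: (l \in S) => //=; rewrite orbC -neq_ltn; exact: (@rank_notin S k kS (l, s) lS).
by rewrite cards0 cardsX cardsT card_bool addn0 muln2.
Qed.

(** Each special pair is above k, below k, or crossed by k. *)
Lemma special_split : #|[set b | [exists a, special a b && ((a \in above) && (b \in above))]]|
  + #|[set b | [exists a, special a b && ((a \in below) && (b \in below))]]|
  + crossings k = npairs.
Proof.
rewrite (card_special [rel a b | (a \in above) && (b \in above)]).
rewrite (card_special [rel a b | (a \in below) && (b \in below)]) /=.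
rewrite !inE /= a0S b0S /= /crossings /npairs.
have := rank_notin kS a0S; have := rank_notin kS b0S.
have := @rank_notin _ _ kS (mirror a0) a0S; have := @rank_notin _ _ kS (mirror b0) b0S.
move: lt_ab0 (ltn_rank_mirror b0 a0); case: eqP => /=; lia.
Qed.

Lemma slots_compl :
  [set c : 'I_q | slot S y k c] = ~: (cell @: above :|: next_cell @^-1: (cell @: below)).
Proof.
apply/setP=> c; rewrite !inE; apply/slotP/norP => [sl|[nA nB] a aS].
  split; apply/negP => /imsetP[a]; rewrite inE => /andP[aS lt] E.
    by have [/(_ (esym (congr1 val E)))] := sl a aS; lia.
  by have [_ /(_ (esym (congr1 val E)))] := sl a aS; lia.
have nk := rank_notin kS aS.
split=> E; rewrite ltnNge; apply/negP => le.
  case/negP: nA; apply/imsetP; exists a; last exact/val_inj.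
  by rewrite inE aS ltn_neqAle eq_sym nk.
case/negP: nB; apply/imsetP; exists a; last exact/val_inj.
by rewrite inE aS ltn_neqAle nk.
Qed.

(** A label above k followed by a label below k is a descent, hence a special pair
    with right-hand side 1. *)
Lemma card_descents :
  #|cell @: above :&: next_cell @^-1: (cell @: below)| = eps * crossings k.
Proof.
pose D := [set b | [exists a, special a b && (rank a < k < rank b)]].
have -> : cell @: above :&: next_cell @^-1: (cell @: below) = if eps then cell @: D else set0.
  apply/setP=> c; rewrite !inE; apply/andP/idP.
    case=> /imsetP[b]; rewrite inE => /andP[bS kb] ->.
    case/imsetP=> a; rewrite inE => /andP[aS ak] E.
    have := Vy true aS bS (ltn_trans ak kb).
    have -> : meets y a b true by apply/eqP; exact: (esym (congr1 val E)).
    case: (eps) => //= sab; apply: imset_f; rewrite inE; apply/existsP; exists a.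
    by rewrite -sab ak.
  case E: (eps); rewrite ?inE // => /imsetP[b]; rewrite inE => /existsP[a /and3P[sab ak kb]] ->.
  have /andP[aS bS] := special_supp a0S b0S sab.
  split; apply/imsetP; first by exists b; rewrite // inE bS.
  exists a; rewrite ?inE ?aS //; apply/val_inj/esym/eqP.
  by have := Vy true aS bS (ltn_trans ak kb); rewrite sab E.
case E: (eps); last by rewrite cards0.
have DS a : a \in D -> a.1 \in S.
  by rewrite inE => /existsP[b /andP[/(special_supp a0S b0S)/andP[]]].
have := card_cells DS; rewrite E mul0n addn0 => ->.
by rewrite mul1n (card_special [rel a b | rank a < k < rank b]).
Qed.

(** Inclusion-exclusion on the two ways in which a slot can be bad for k. *)
Lemma card_slots : #|[set c : 'I_q | slot S y k c]| + #|S|.*2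
  = q + (if eps then crossings k else npairs - crossings k).
Proof.
have := cardsC [set c : 'I_q | slot S y k c]; rewrite {2}slots_compl setCK card_ord.
have := cardsUI (cell @: above) (next_cell @^-1: (cell @: below)).
rewrite card_descents (on_card_preimset (onW_bij _ (injF_bij next_cell_inj))).
have aS a : a \in above -> a.1 \in S by rewrite inE => /andP[].
have bS a : a \in below -> a.1 \in S by rewrite inE => /andP[].
have := card_cells aS; have := card_cells bS; have := special_split; have := card_above_below.
case: (eps) => /=; lia.
Qed.
End Slots.

Definition factor T k := if eps then T + crossings k else T + npairs - crossings k.

(** A placement of k and of the labels in S on Z_(q+2) is the same as a placement of
    the labels in S on Z_q with a slot for k. *)
Lemma card_configs_insert q (S : {set 'I_m}) (k : 'I_m) :
  k \notin S -> a0.1 \in S -> b0.1 \in S -> #|S|.*2 <= q ->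
  #|configs q.+2 (k |: S)| = #|configs q S| * factor (q - #|S|.*2) k.
Proof.
move=> kS a0S b0S leq.
pose ins (u : {ffun 'I_m -> 'I_q} * 'I_q) : {ffun 'I_m -> 'I_q.+2} :=
  [ffun l => if l == k then Ordinal (new_cell_lt (ltn_ord u.2))
             else Ordinal (widenc_lt (ltn_ord u.2) (ltn_ord (u.1 l)))].
pose X := [set u : {ffun 'I_m -> 'I_q} * 'I_q | (u.1 \in configs q S) && slot S u.1 k u.2].
have insk u : ins u k = new_cell q u.2 :> nat by rewrite ffunE eqxx.
have insS u l : l != k -> ins u l = widenc q u.2 (u.1 l) :> nat.
  by move=> /negbTE lk; rewrite ffunE lk.
have -> : configs q.+2 (k |: S) = ins @: X.
  apply/setP=> x; apply/configsP/imsetP; last first.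
    case=> -[y c]; rewrite inE /= => /andP[/configsP[V Z] sl] ->; split.
      apply: (valid_of_slot kS a0S b0S (y := y) (c := c) (insk (y, c)) _ V sl).
      exact: (insS (y, c)).
    move=> l; rewrite !inE negb_or => /andP[lk /Z y0].
    rewrite insS //= y0 /widenc /low_cell; have := ltn_ord c; case: ifP; lia.
  case=> V Z.
  have kin : k \in k |: S by rewrite !inE eqxx.
  have lt_k : rank (k, false) < rank (k, true) by rewrite /rank /=; have := ltn_ord k; lia.
  have nsp : special (k, false) (k, true) = false.
    by rewrite (special_notin kS a0S b0S) ?eqxx.
  have Vk e := V (k, false) (k, true) e kin kin lt_k.
  (* The slot c is read off from x k, which the equations of the pair (k, -k) allow. *)
  have [c cq cE] : exists2 c, c < q & new_cell q c = x k.
    apply: new_cell_surj => //.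
      by have := Vk false; rewrite nsp andbF /meets /place /= => ->.
    by have := Vk true; rewrite nsp andbF /meets /place /= => ->.
  (* No old label sits in a deleted cell, so every other coordinate can be pulled back. *)
  have ex l : exists t : 'I_q, if l == k then t == 0 :> nat else widenc q c t == x l.
    have [_|lk] := eqVneq l k; first by exists (Ordinal (leq_ltn_trans (leq0n c) cq)).
    have nkl s : x l <> place x (k, s) :> nat.
      case lS: (l \in S); last first.
        have -> : x l = 0 :> nat by apply: Z; rewrite !inE negb_or lk lS.
        have := new_cell_oppc cq; rewrite cE; have := ltn_ord (x k).
        by case: s; rewrite /place /=; cell_lia.
      have lin : l \in k |: S by rewrite !inE lS orbT.
      case: (ltngtP (rank (l, false)) (rank (k, s))) => [lt|lt|/rank_inj[E _]].
      - have := V (l, false) (k, s) false lin kin lt; 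
        rewrite (special_notin kS a0S b0S) ?eqxx ?orbT // andbF.
        by move=> /negbT/eqP.
      - have := V (k, s) (l, false) false kin lin lt; 
        rewrite (special_notin kS a0S b0S) ?eqxx ?orbT // andbF.
        by move=> /negbT/eqP E /esym.
      - by rewrite E eqxx in lk.
    have [||t tq E] := @widenc_surj q c cq (x l) (ltn_ord _).
    - by rewrite cE; apply: (nkl false).
    - by rewrite cE; apply: (nkl true).
    by exists (Ordinal tq); rewrite E.
  have [y yP] : exists y : {ffun 'I_m -> 'I_q}, forall l,
      if l == k then y l == 0 :> nat else widenc q c (y l) == x l.
    by exists [ffun l => xchoose (ex l)] => l; rewrite ffunE; apply: xchooseP (ex l).
  have yk : y k = 0 :> nat by apply/eqP; have := yP k; rewrite eqxx.
  have yE l : l != k -> x l = widenc q c (y l) :> nat.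
    by move=> lk; apply/esym/eqP; have := yP l; rewrite (negbTE lk).
  exists (y, Ordinal cq).
    have := slot_of_valid kS a0S b0S (c := Ordinal cq) (esym cE) yE V.
    rewrite inE /= => -[Vy ->]; rewrite andbT; apply/configsP; split=> // l lS.
    have [->|lk] := eqVneq l k; first exact: yk.
    have x0 : x l = 0 :> nat by apply: Z; rewrite !inE negb_or lk.
    by move: (yE l lk); rewrite x0 /widenc; lia.
  apply/ffunP=> l; apply: val_inj; have [->|lk] := eqVneq l k; first by rewrite /= insk -cE.
  by rewrite /= insS //= yE.
rewrite card_in_imset; last first.
  move=> [y c] [y' c']; rewrite /X 2!inE /= => /andP[/configsP[_ Z] _] /andP[/configsP[_ Z'] _] E.
  have Ec : c = c'.
    apply/val_inj/(new_cell_inj (ltn_ord c) (ltn_ord c')).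
    by rewrite -(insk (y, c)) E insk.
  subst c'; congr pair; apply/ffunP=> l; apply: val_inj.
  have [->|lk] := eqVneq l k; first by rewrite /= Z // Z'.
  apply: (@widenc_inj q c) => //=.
  by have := insS (y, c) l lk; rewrite E (insS (y', c) l lk).
rewrite -sum1_card.
under eq_bigl => u do rewrite inE.
rewrite -(pair_big_dep (fun y => y \in configs q S)
  (fun y (c : 'I_q) => slot S y k c) (fun _ _ => 1)) /=.
rewrite (eq_bigr (fun=> factor (q - #|S|.*2) k)) ?sum_nat_const // => y /configsP[Vy _].
rewrite sum1_card; have := card_slots kS a0S b0S Vy; rewrite cardsE /factor.
have : crossings k <= npairs by rewrite /crossings /npairs; case: eqP => /=; lia.
case: eps; lia.
Qed.

(** The circle has 2 #|S| + T cells at every stage, so T is the same in all factors. *)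
Lemma card_configs_setT T (S : {set 'I_m}) :
  a0.1 \in S -> b0.1 \in S ->
  #|configs (m.*2 + T) [set: 'I_m]|
  = #|configs (#|S|.*2 + T) S| * \prod_(k < m | k \notin S) factor T k.
Proof.
move: {2}#|~: S| (erefl #|~: S|) => n; elim: n S => [|n IH] S cS a0S b0S.
  move/eqP: cS; rewrite cards_eq0 => /eqP E; have ST : S = setT by rewrite -(setCK S) E setC0.
  rewrite ST cardsT card_ord big_pred0 ?muln1 // => k; by rewrite inE.
have /card_gt0P[k] : 0 < #|~: S| by rewrite cS.
rewrite inE => kS.
rewrite (IH (k |: S)) ?inE ?a0S ?b0S ?orbT //; last first.
  by rewrite setCU setIC -setDE; have := cardsD1 k (~: S); rewrite inE kS cS => -[].
rewrite (cardsU1 k) kS add1n doubleS !addSn card_configs_insert ?leq_addr //.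
rewrite addKn -mulnA; congr muln; rewrite [in RHS](bigD1 k) //=; congr muln.
by apply: eq_bigl => l; rewrite !inE negb_or andbC.
Qed.
End Pair.
End Labels.

(** * Configurations of the special labels alone *)

Lemma card_ord_mem q (L : seq nat) (P : pred nat) :
  uniq L -> all (fun t => t < q) L -> (forall t, t < q -> P t = (t \in L)) ->
  #|[set t : 'I_q | P t]| = size L.
Proof.
move=> uL /allP ltL PL.
rewrite cardE -(size_map val); apply/perm_size/uniq_perm => //.
  by rewrite map_inj_uniq ?enum_uniq //; apply: val_inj.
move=> t; apply/mapP/idP => [[u] | tL].
  by rewrite mem_enum inE => Pu ->; rewrite -PL ?ltn_ord.
by exists (Ordinal (ltL t tL)); rewrite // mem_enum inE PL ?ltL.
Qed.

Lemma card_ord_notin q (L : seq nat) (P : pred nat) :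
  uniq L -> all (fun t => t < q) L -> (forall t, t < q -> P t = (t \notin L)) ->
  #|[set t : 'I_q | P t]| = q - size L.
Proof.
move=> uL ltL PL; rewrite -(card_ord_mem (P := fun t => t \in L) uL ltL) //.
have -> : [set t : 'I_q | P t] = ~: [set t : 'I_q | val t \in L].
  by apply/setP=> t; rewrite !inE PL.
have := cardsC [set t : 'I_q | val t \in L]; rewrite card_ord => E.
apply/eqP; rewrite -(eqn_add2l #|[set t : 'I_q | val t \in L]|) E subnKC //.
by rewrite -[X in _ <= X]E leq_addr.
Qed.

Lemma prod_ord_neq1 m (i : 'I_m) (G : nat -> nat) A C :
  (forall k, k < i -> G k = A) -> (forall k, i < k < m -> G k = C) ->
  \prod_(k < m | k \notin [set i]) G k = A ^ i * C ^ (m - i.+1).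
Proof.
move=> GA GC; rewrite big_mkcond /=.
rewrite (eq_bigr (fun k : 'I_m => if val k == i then 1 else G k)); last first.
  by move=> k _; rewrite inE -val_eqE; case: eqP.
rewrite -(big_mkord xpredT (fun k => if k == i then 1 else G k)).
rewrite (big_cat_nat _ (n := i)) ?(ltnW (ltn_ord i)) //= [X in _ * X]big_ltn //.
rewrite eqxx mul1n; congr muln.
  rewrite (eq_big_nat _ _ (F2 := fun=> A)) ?prod_nat_const_nat ?subn0 // => k /andP[_ ki].
  by rewrite ltn_eqF // GA.
rewrite (eq_big_nat _ _ (F2 := fun=> C)) ?prod_nat_const_nat // => k /andP[ik km].
by rewrite gtn_eqF // GC // ik.
Qed.

Lemma prod_ord_neq2 m (i j : 'I_m) (G : nat -> nat) A B C : i < j ->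
  (forall k, k < i -> G k = A) -> (forall k, i < k < j -> G k = B) ->
  (forall k, j < k < m -> G k = C) ->
  \prod_(k < m | k \notin [set i; j]) G k = A ^ i * B ^ (j - i.+1) * C ^ (m - j.+1).
Proof.
move=> ij GA GB GC; rewrite big_mkcond /=.
rewrite (eq_bigr (fun k : 'I_m => if (val k == i) || (val k == j) then 1 else G k)); last first.
  by move=> k _; rewrite !inE -!val_eqE; case: orP.
rewrite -(big_mkord xpredT (fun k => if (k == i) || (k == j) then 1 else G k)).
rewrite (big_cat_nat _ (n := j)) ?(ltnW (ltn_ord j)) //= [X in _ * X]big_ltn //.
rewrite eqxx orbT mul1n; congr muln; last first.
  rewrite (eq_big_nat _ _ (F2 := fun=> C)) ?prod_nat_const_nat // => k /andP[jk km].
  by rewrite (gtn_eqF (ltn_trans ij jk)) gtn_eqF // GC // jk.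
rewrite (big_cat_nat _ (n := i)) ?(ltnW ij) //= [X in _ * X]big_ltn //.
rewrite eqxx mul1n; congr muln.
  rewrite (eq_big_nat _ _ (F2 := fun=> A)) ?prod_nat_const_nat ?subn0 // => k /andP[_ ki].
  by rewrite ltn_eqF // (ltn_eqF (ltn_trans ki ij)) GA.
rewrite (eq_big_nat _ _ (F2 := fun=> B)) ?prod_nat_const_nat // => k /andP[ik kj].
by rewrite gtn_eqF // ltn_eqF // GB // ik.
Qed.

Section Base.
Variables (m q : nat) (eps : bool).

Section One.
Variable i : 'I_m.
Notation configs := (configs (i, false) (i, true) eps).
Definition double_ok (t : nat) : bool :=
  ((t == oppc q t) == ~~ eps) && ((t == nextc q (oppc q t)) == eps).

Lemma card_configs_double :
  #|configs q [set i]| = #|[set t : 'I_q | double_ok t]|.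
Proof.
have ri : rank (i, false) < rank (i, true) by rewrite /rank /=; have := ltn_ord i; lia.
have sp : special (i, false) (i, true) (i, false) (i, true).
  by rewrite /special !eqxx.
have ok (y : {ffun 'I_m -> 'I_q}) : valid (i, false) (i, true) eps [set i] y <-> double_ok (y i).
  split=> [V|/andP[/eqP ok0 /eqP ok1] a b e]; last first.
    case: a b => [a s] [b s']; rewrite !inE /= => /eqP-> /eqP->.
    case: s; case: s'; rewrite ?ltnn // 1?ltnNge 1?(ltnW ri) // => _.
    rewrite sp /meets /place /=; case: e; rewrite ?ok0 ?ok1; by case: eps.
  have V' e := V (i, false) (i, true) e (set11 i) (set11 i) ri.
  have := V' true; have := V' false; rewrite sp /meets /place /= /double_ok => -> ->.
  by case: eps.
have -> : [set t : 'I_q | double_ok t] = [set (y : {ffun 'I_m -> 'I_q}) i | y in configs q [set i]].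
  apply/setP=> t; rewrite inE; apply/idP/imsetP => [ht|[y /configsP[V _] ->]]; last exact/ok.
  have q0 : 0 < q := leq_ltn_trans (leq0n t) (ltn_ord t).
  exists [ffun k => if k == i then t else Ordinal q0]; last by rewrite ffunE eqxx.
  apply/configsP; split; first by apply/ok; rewrite ffunE eqxx.
  by move=> k; rewrite inE ffunE => /negbTE->.
rewrite card_in_imset // => y y' /configsP[_ Z] /configsP[_ Z'] E.
apply/ffunP=> k; have [->//|ki] := eqVneq k i.
by apply: val_inj; rewrite /= Z ?Z' ?inE.
Qed.
End One.

Section Two.
Variables (i j : 'I_m) (s : bool).
Hypothesis ij : i < j.
Notation configs := (configs (i, false) (j, s) eps).
Definition pair_ok (t u : nat) : bool :=
  [&& ((t == u) == ~~ eps && ~~ s), ((t == nextc q u) == eps && ~~ s),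
      ((t == oppc q u) == ~~ eps && s), ((t == nextc q (oppc q u)) == eps && s),
      t != oppc q t, t != nextc q (oppc q t), u != oppc q u & u != nextc q (oppc q u)].

(** Up to mirroring, the labels i, j, -i, -j form only the pairs (i, j), (i, -j),
    (i, -i) and (j, -j). *)
Lemma valid_pair (y : {ffun 'I_m -> 'I_q}) :
  valid (i, false) (j, s) eps [set i; j] y <-> pair_ok (y i) (y j).
Proof.
have im := ltn_ord i; have jm := ltn_ord j.
have iS : i \in [set i; j] by rewrite !inE eqxx.
have jS : j \in [set i; j] by rewrite !inE eqxx orbT.
have nij : (i == j) = false by rewrite -val_eqE /= ltn_eqF.
have nji : (j == i) = false by rewrite eq_sym.
have sp1 s' : special (i, false) (j, s) (i, false) (j, s') = (s' == s).
  rewrite /special /mirror /= !xpair_eqE !eqxx /= nij /= orbF.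
  by case: s; case: s'.
have sp2 : special (i, false) (j, s) (i, false) (i, true) = false.
  by rewrite /special /mirror /= !xpair_eqE !eqxx /= nij ?andbF.
have sp3 : special (i, false) (j, s) (j, false) (j, true) = false.
  by rewrite /special /mirror /= !xpair_eqE !eqxx /= nji ?andbF.
split=> [V|].
  have V1 s' e := V (i, false) (j, s') e iS jS.
  have V2 e := V (i, false) (i, true) e iS iS.
  have V3 e := V (j, false) (j, true) e jS jS.
  have r1 s' : rank (i, false) < rank (j, s') by rewrite /rank /=; case: s'; lia.
  have r2 : rank (i, false) < rank (i, true) by rewrite /rank /=; lia.
  have r3 : rank (j, false) < rank (j, true) by rewrite /rank /=; lia.
  have := V1 false false (r1 _); have := V1 false true (r1 _).
  have := V1 true false (r1 _); have := V1 true true (r1 _).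
  have := V2 false r2; have := V2 true r2; have := V3 false r3; have := V3 true r3.
  rewrite !sp1 sp2 sp3 !andbF /meets /place /= /pair_ok => -> -> -> -> -> -> -> ->.
  by case: eps; case: s.
rewrite /pair_ok => /and5P[/eqP o1 /eqP o2 /eqP o3 /eqP o4].
case/and4P=> /negbTE o5 /negbTE o6 /negbTE o7 /negbTE o8.
pose reps := [:: ((i, false), (j, false)); ((i, false), (j, true));
                 ((i, false), (i, true)); ((j, false), (j, true))].
have W a b e : rank a < rank b -> (a, b) \in reps -> meets y a b e
    = (e == eps) && special (i, false) (j, s) a b.
  move=> _; rewrite /reps !inE => /or4P[]/eqP[-> ->]; rewrite ?sp1 ?sp2 ?sp3 /meets /place /=;
    case: e => /=; rewrite ?(o1, o2, o3, o4, o5, o6, o7, o8); by case: eps; case: s.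
move=> a b e aS bS ab.
have [in1|nin1] := boolP ((a, b) \in reps); first exact: W.
rewrite -meets_mirror -special_mirror; apply: W; first by rewrite ltn_rank_mirror.
case: a b ab aS bS nin1 => [a sa] [b sb]; rewrite /mirror /rank /= => ab.
rewrite /reps !inE => /orP[]/eqP E /orP[]/eqP E'; subst a b; move: ab.
all: by case: sa; case: sb; rewrite /= !xpair_eqE /= ?eqxx ?nij ?nji ?andbF ?orbT //=; lia.
Qed.

(** The equation of H gives the second coordinate as a function g of the first. *)
Lemma card_configs_pair (g : nat -> nat) :
  (forall t, t < q -> g t < q) ->
  (forall t u, t < q -> u < q -> pair_ok t u -> u = g t) ->
  #|configs q [set i; j]| = #|[set t : 'I_q | pair_ok t (g t)]|.
Proof.
move=> gq gE.
have nji : (j == i) = false by rewrite -val_eqE /= gtn_eqF.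
have yj y : y \in configs q [set i; j] -> y j = g (y i) :> nat.
  by case/configsP => /valid_pair /gE -> //; apply: ltn_ord.
have -> : [set t : 'I_q | pair_ok t (g t)]
    = [set (y : {ffun 'I_m -> 'I_q}) i | y in configs q [set i; j]].
  apply/setP=> t; rewrite inE; apply/idP/imsetP => [ht|[y yc ->]]; last first.
    by rewrite -(yj y yc); apply/valid_pair; case/configsP: yc.
  have q0 : 0 < q := leq_ltn_trans (leq0n t) (ltn_ord t).
  pose u := Ordinal (gq t (ltn_ord t)).
  exists [ffun k => if k == i then t else if k == j then u else Ordinal q0];
    last by rewrite ffunE eqxx.
  apply/configsP; split; first by apply/valid_pair; rewrite !ffunE !eqxx nji.
  by move=> k; rewrite !inE ffunE negb_or => /andP[/negbTE-> /negbTE->].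
rewrite card_in_imset // => y y' yc y'c E.
have := yj y yc; have := yj y' y'c; rewrite E => <- Ej.
case/configsP: yc => _ Z; case/configsP: y'c => _ Z'.
apply/ffunP=> k; have [->//|ki] := eqVneq k i.
have [->|kj] := eqVneq k j; first exact: val_inj.
by apply: val_inj; rewrite /= Z ?Z' ?inE ?negb_or ?ki ?kj.
Qed.
End Two.
End Base.

Lemma odd_double_cases q : exists h, if odd q then q = h.*2.+1 else q = h.*2.
Proof. by exists q./2; have := odd_double_half q; case: odd; lia. Qed.

(** Here the circle has q = 2 + T cells, with T = 2h or 2h + 1, and L lists the
    solutions t of 2t = e modulo q. *)
Lemma card_base_double T m (i : 'I_m) (e : bool) : 0 < T ->
  #|configs (i, false) (i, true) e (2 + T) [set i]|
  = (if odd T then 1 else if e then 0 else 2).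
Proof.
move=> T0; rewrite card_configs_double.
have [h hT] := odd_double_cases T.
pose L := match odd T, e with
  | true, false => [:: 0] | true, true => [:: h.+2]
  | false, false => [:: 0; h.+1] | false, true => [::] end.
rewrite (@card_ord_mem _ L (double_ok (2 + T) e)) /L => {L}.
- by case: odd; case: e.
- by case: odd; case: e.
- by move: hT; case: odd; case: e => hT /=; lia.
move=> t tq; rewrite /double_ok; move: hT; case: odd; case: e => hT;
  rewrite ?(inE, in_nil); cell_lia.
Qed.

Section Pairs.
Variables (m : nat) (i j : 'I_m).
Hypothesis ij : i < j.

(** In the four counts below the circle has q = 4 + T cells, with T = 2h or 2h + 1,
    and L lists the forbidden positions t = x_i. Here they are the solutions of
    2t = 0 and 2t = 1. *)
Lemma card_base_sub0 T : 0 < T ->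
  #|configs (i, false) (j, false) false (4 + T) [set i; j]| = T + 2.
Proof.
move=> T0; rewrite (card_configs_pair ij (g := id)) //; last first.
  by move=> t u tq uq /and5P[/eqP H _ _ _ _]; apply/esym/eqP; rewrite H.
have [h hT] := odd_double_cases T.
pose L := if odd T then [:: 0; h.+3] else [:: 0; h.+2].
rewrite (@card_ord_notin _ L (fun t => pair_ok (4 + T) false false t t)) /L.
- by case: odd => /=; lia.
- by case: odd.
- by move: hT; case: odd => hT /=; lia.
move=> t tq; rewrite /pair_ok; move: hT; case: odd => hT; rewrite !inE; cell_lia.
Qed.

(** Now x_j = t - 1, and the forbidden values of 2t are 0, 1, 2 and 3. *)
Lemma card_base_sub1 T : 0 < T ->
  #|configs (i, false) (j, false) true (4 + T) [set i; j]| = T.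
Proof.
move=> T0; pose g t := oppc (4 + T) (nextc (4 + T) (oppc (4 + T) t)).
rewrite (card_configs_pair ij (g := g)) /g.
- have [h hT] := odd_double_cases T.
  pose L := if odd T then [:: 0; h.+3; 1; h.+4] else [:: 0; h.+2; 1; h.+3].
  rewrite (@card_ord_notin _ L (fun t => pair_ok (4 + T) true false t (g t))) /L.
  + by case: odd => /=; lia.
  + by move: hT; case: odd => hT /=; rewrite ?inE; lia.
  + by move: hT; case: odd => hT /=; lia.
  move=> t tq; rewrite /pair_ok /g; move: hT; case: odd => hT; rewrite !inE; cell_lia.
- by move=> t tq; cell_lia.
by move=> t u tq uq /and5P[_ /eqP H _ _ _]; move: H; cell_lia.
Qed.

(** Now x_j = - t, and the forbidden values of 2t are 0, 1 and -1. *)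
Lemma card_base_add0 T : 0 < T ->
  #|configs (i, false) (j, true) false (4 + T) [set i; j]|
  = if odd T then T + 1 else T + 2.
Proof.
move=> T0; rewrite (card_configs_pair ij (g := oppc (4 + T))).
- have [h hT] := odd_double_cases T.
  pose L := if odd T then [:: 0; h.+3; h.+2] else [:: 0; h.+2].
  rewrite (@card_ord_notin _ L (fun t => pair_ok (4 + T) false true t (oppc (4 + T) t))) /L.
  + by case: odd => /=; lia.
  + by move: hT; case: odd => hT /=; rewrite ?inE; lia.
  + by move: hT; case: odd => hT /=; lia.
  move=> t tq; rewrite /pair_ok; move: hT; case: odd => hT; rewrite !inE; cell_lia.
- by move=> t tq; cell_lia.
by move=> t u tq uq /and5P[_ _ /eqP H _ _]; move: H; cell_lia.
Qed.

(** Now x_j = 1 - t, and the forbidden values of 2t are 0, 1 and 2. *)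
Lemma card_base_add1 T : 0 < T ->
  #|configs (i, false) (j, true) true (4 + T) [set i; j]|
  = if odd T then T + 1 else T.
Proof.
move=> T0; rewrite (card_configs_pair ij (g := fun t => nextc (4 + T) (oppc (4 + T) t))).
- have [h hT] := odd_double_cases T.
  pose L := if odd T then [:: 0; h.+3; 1] else [:: 0; h.+2; 1; h.+3].
  rewrite (@card_ord_notin _ L
    (fun t => pair_ok (4 + T) true true t (nextc (4 + T) (oppc (4 + T) t)))) /L.
  + by case: odd => /=; lia.
  + by move: hT; case: odd => hT /=; rewrite ?inE; lia.
  + by move: hT; case: odd => hT /=; lia.
  move=> t tq; rewrite /pair_ok; move: hT; case: odd => hT; rewrite !inE; cell_lia.
- by move=> t tq; cell_lia.
by move=> t u tq uq /and5P[_ _ _ /eqP H _]; move: H; cell_lia.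
Qed.
End Pairs.

Lemma card_full_double m (i : 'I_m) T e : 0 < T ->
  #|configs (i, false) (i, true) e (m.*2 + T) [set: 'I_m]|
  = (if odd T then 1 else if e then 0 else 2)
    * ((if e then T else T.+1) ^ i * (if e then T.+1 else T) ^ (m - i.+1)).
Proof.
move=> T0; have im := ltn_ord i.
have lt : rank (i, false) < rank (i, true) by rewrite /rank /=; lia.
rewrite (card_configs_setT e lt T (S := [set i])) ?inE // cards1 card_base_double //; congr muln.
apply: (@prod_ord_neq1 m i (factor (i, false) (i, true) e T)) => k kk;
  rewrite /factor /crossings /npairs /mirror /rank /= eqxx /=; case: e; lia.
Qed.

Section Totals.
Variables (m : nat) (i j : 'I_m) (T : nat).
Hypotheses (ij : i < j) (T0 : 0 < T).

Lemma card_full_pair s e A B C :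
  (forall k, k < i -> factor (i, false) (j, s) e T k = A) ->
  (forall k, i < k < j -> factor (i, false) (j, s) e T k = B) ->
  (forall k, j < k < m -> factor (i, false) (j, s) e T k = C) ->
  #|configs (i, false) (j, s) e (m.*2 + T) [set: 'I_m]|
  = #|configs (i, false) (j, s) e (4 + T) [set i; j]|
    * (A ^ i * B ^ (j - i.+1) * C ^ (m - j.+1)).
Proof.
move=> HA HB HC; have jm := ltn_ord j.
have lt : rank (i, false) < rank (j, s).
  by rewrite /rank /=; case: (s); lia.
rewrite (card_configs_setT e lt T (S := [set i; j])) ?inE ?eqxx ?orbT // cards2.
by rewrite -val_eqE /= (ltn_eqF ij) (prod_ord_neq2 ij HA HB HC).
Qed.

Ltac factor_lia :=
  move=> k kk; have im := ltn_ord i; have jm := ltn_ord j;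
  rewrite /factor /crossings /npairs /mirror /rank /= ?xpair_eqE -?val_eqE /=
    ?(gtn_eqF ij) /=; lia.

Lemma card_full_sub0 :
  #|configs (i, false) (j, false) false (m.*2 + T) [set: 'I_m]|
  = (T + 2) * ((T + 2) ^ i * (T + 1) ^ (j - i.+1) * (T + 2) ^ (m - j.+1)).
Proof.
by rewrite (@card_full_pair _ _ (T + 2) (T + 1) (T + 2)) ?card_base_sub0 //; factor_lia.
Qed.

Lemma card_full_sub1 :
  #|configs (i, false) (j, false) true (m.*2 + T) [set: 'I_m]|
  = T * (T ^ i * (T + 1) ^ (j - i.+1) * T ^ (m - j.+1)).
Proof.
by rewrite (@card_full_pair _ _ T (T + 1) T) ?card_base_sub1 //; factor_lia.
Qed.

Lemma card_full_add0 :
  #|configs (i, false) (j, true) false (m.*2 + T) [set: 'I_m]|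
  = (if odd T then T + 1 else T + 2)
    * ((T + 2) ^ i * (T + 1) ^ (j - i.+1) * T ^ (m - j.+1)).
Proof.
by rewrite (@card_full_pair _ _ (T + 2) (T + 1) T) ?card_base_add0 //; factor_lia.
Qed.

Lemma card_full_add1 :
  #|configs (i, false) (j, true) true (m.*2 + T) [set: 'I_m]|
  = (if odd T then T + 1 else T)
    * (T ^ i * (T + 1) ^ (j - i.+1) * (T + 2) ^ (m - j.+1)).
Proof.
by rewrite (@card_full_pair _ _ T (T + 1) (T + 2)) ?card_base_add1 //; factor_lia.
Qed.
End Totals.

(** * From hyperplanes to labels *)

Lemma mem_bigcup_seq (I : Type) (T : finType) (r : seq I) (P : pred I)
    (F : I -> {set T}) (x : T) :
  (x \in \bigcup_(i <- r | P i) F i) = has (fun i => P i && (x \in F i)) r.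
Proof.
rewrite (big_morph (fun A : {set T} => x \in A) (id1 := false) (op1 := orb)).
- exact: big_has_cond.
- by move=> A B; rewrite inE.
- by rewrite inE.
Qed.

Section Bridge.
Local Open Scope ring_scope.
Variable m : nat.
Local Notation label := (label m).

(** The left-hand side of x_a = x_b + e is x_a - x_b, a difference of two signed
    basis vectors. *)
Definition label_vec (a : label) : 'rV[int]_m := if a.2 then - delta_mx 0 a.1 else delta_mx 0 a.1.
Definition label_hyp (a b : label) (e : bool) : hyperplane m :=
  (label_vec a - label_vec b, (e : nat)%:Z).

Lemma label_vec_mirror a : label_vec (mirror a) = - label_vec a.
Proof. by case: a => k []; rewrite /label_vec /= ?opprK. Qed.

Lemma label_hyp_mirror a b e : label_hyp (mirror b) (mirror a) e = label_hyp a b e.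
Proof. by rewrite /label_hyp !label_vec_mirror opprK addrC. Qed.

Lemma hyp_double_label i (e : bool) :
  hyp_double i (e : nat)%:Z = label_hyp (i, false) (i, true) e.
Proof. by rewrite /hyp_double /label_hyp /label_vec /= opprK scaler_nat mulr2n. Qed.

Lemma hyp_sub_label i j (e : bool) :
  hyp_sub i j (e : nat)%:Z = label_hyp (i, false) (j, false) e.
Proof. by []. Qed.

Lemma hyp_add_label i j (e : bool) :
  hyp_add i j (e : nat)%:Z = label_hyp (i, false) (j, true) e.
Proof. by rewrite /hyp_add /label_hyp /label_vec /= opprK. Qed.

Lemma mem_shi_typeC (K : hyperplane m) :
  reflect (exists a b e, (rank a < rank b)%N /\ K = label_hyp a b e) (K \in shi_typeC m).
Proof.
have mem2 (b : int) : (b \in [:: 0; 1]) -> exists e : bool, b = (e : nat)%:Z.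
  by rewrite !inE => /orP[]/eqP->; [exists false | exists true].
have memb (e : bool) : (e : nat)%:Z \in [:: 0 : int; 1] by case: e.
apply: (iffP idP).
  rewrite /shi_typeC !mem_cat => /or3P[] /allpairsP[[p b] /= [+ /mem2[e ->] ->]].
  - move=> _; exists (p, false), (p, true), e; rewrite hyp_double_label; split=> //.
    by rewrite /rank /=; have := ltn_ord p; lia.
  - rewrite mem_filter => /andP[/= lt _].
    by exists (p.1, false), (p.2, false), e; rewrite hyp_sub_label.
  - rewrite mem_filter => /andP[/= lt _].
    exists (p.1, false), (p.2, true), e; rewrite hyp_add_label; split=> //.
    by case: p lt => i j /= ij; rewrite /rank /=; have := ltn_ord j; lia.
have mem_pair (i j : 'I_m) s e : (i < j)%N -> label_hyp (i, false) (j, s) e \in shi_typeC m.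
  move=> ij; rewrite /shi_typeC !mem_cat; case: s.
    apply/or3P/Or33/allpairsP; exists ((i, j), (e : nat)%:Z); split=> //=.
      by rewrite mem_filter /= ij mem_enum.
    by rewrite hyp_add_label.
  apply/or3P/Or32/allpairsP; exists ((i, j), (e : nat)%:Z); split=> //=.
  by rewrite mem_filter /= ij mem_enum.
have mem_double (i : 'I_m) e : label_hyp (i, false) (i, true) e \in shi_typeC m.
  rewrite /shi_typeC !mem_cat; apply/or3P/Or31/allpairsP.
  by exists (i, (e : nat)%:Z); split=> //=; rewrite ?mem_enum ?hyp_double_label.
case=> -[i s] [[j s'] [e [lt ->]]].
have := ltn_ord i; have := ltn_ord j; move: lt; rewrite /rank /=.
case: s; case: s' => lt ljm lim; try lia.
- by rewrite -label_hyp_mirror; apply: mem_pair => /=; lia.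
- case: (ltngtP i j) => [l|l|/val_inj ->]; first exact: mem_pair.
    by rewrite -label_hyp_mirror; apply: mem_pair.
  exact: mem_double.
exact: mem_pair.
Qed.

Lemma label_vecE a k : label_vec a 0 k = if a.1 == k then (if a.2 then -1 else 1) else 0.
Proof. by case: a => l []; rewrite /label_vec /= !mxE eqxx /= eq_sym; case: eqP. Qed.

(** The vector of (a, b) is the sum of the signed basis vectors of a and -b, which do
    not cancel as a <> b; so it determines {a, -b}, that is (a, b) up to mirroring. *)
Lemma label_hyp_eq a b e a' b' e' : (rank a < rank b)%N -> (rank a' < rank b')%N ->
  (label_hyp a b e == label_hyp a' b' e') = (e == e') && special a' b' a b.
Proof.
move=> ab ab'; apply/eqP/andP => [[/matrixP E Ee]|[/eqP-> /orP[]/andP[/eqP-> /eqP->]]]; last first.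
- by rewrite label_hyp_mirror.
- by [].
split; first by case: e e' Ee {E} => [] [].
have {}E k : label_vec a 0 k - label_vec b 0 k = label_vec a' 0 k - label_vec b' 0 k.
  by have := E 0 k; rewrite !mxE.
(* Only the coordinates that occur in the two equations matter. *)
have Ea := E a.1; have Eb := E b.1; have Ea' := E a'.1; have Eb' := E b'.1.
move: ab ab' Ea Eb Ea' Eb' {E}; rewrite !label_vecE !eqxx /special /mirror.
case: a b a' b' => [a s] [b t] [a' s'] [b' t']; rewrite /rank !xpair_eqE /=.
rewrite (eq_sym b a) (eq_sym a' a) (eq_sym a' b) (eq_sym b' a) (eq_sym b' b) (eq_sym b' a').
have := ltn_ord a; have := ltn_ord b; have := ltn_ord a'; have := ltn_ord b'.
case: (eqVneq a b) => [?|_]; case: (eqVneq a a') => [?|_];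
case: (eqVneq a b') => [?|_]; case: (eqVneq b a') => [?|_];
case: (eqVneq b b') => [?|_]; case: (eqVneq a' b') => [?|_]; subst => //=; rewrite ?eqxx //=;
case: s; case: t; case: s'; case: t' => //=; lia.
Qed.

Section Mod.
Variable n : nat.
Local Notation q := n.+2.

Lemma val_oppZ (u : 'Z_q) : - u = oppc q u :> nat.
Proof.
have uq : (u < q)%N := ltn_ord u.
change ((q - u) %% q = oppc q u)%N; rewrite /oppc; case: (eqVneq (u : nat) 0%N) => [->|ne].
  by rewrite subn0 modnn.
by rewrite modn_small //; lia.
Qed.

Lemma val_succZ (u : 'Z_q) : u + 1 = nextc q u :> nat.
Proof.
have uq : (u < q)%N := ltn_ord u.
change ((u + 1 %% q) %% q = nextc q u)%N; rewrite (modn_small (_ : 1 < q)%N) // addn1 /nextc.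
case: eqP => [->|ne]; first by rewrite modnn.
by rewrite modn_small //; lia.
Qed.

Definition coords (x : 'rV['Z_q]_m) : {ffun 'I_m -> 'I_q} := [ffun k => x 0 k].

Definition label_val (x : 'rV['Z_q]_m) (a : label) : 'Z_q := if a.2 then - x 0 a.1 else x 0 a.1.

Lemma label_val_place x a : label_val x a = place (coords x) a :> nat.
Proof.
rewrite /label_val /place /coords ffunE; case: a.2 => //.
exact: val_oppZ.
Qed.

Lemma mem_hyp_mod x a b e : (x \in hyp_mod q (label_hyp a b e)) = meets (coords x) a b e.
Proof.
have S (c : label) : \sum_(k < m) (label_vec c 0 k)%:~R * x 0 k = label_val x c.
  rewrite (bigD1 c.1) //= big1 => [|k kc]; last first.
    by rewrite label_vecE eq_sym (negbTE kc) mul0r.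
  rewrite label_vecE eqxx addr0 /label_val; case: c.2; last by rewrite mul1r.
  by rewrite rmorphN1 mulN1r.
rewrite inE /=.
under eq_bigr => k _ do rewrite !mxE rmorphB mulrBl.
rewrite big_split /= sumrN !S subr_eq addrC /meets -!label_val_place.
by case: e; rewrite ?addr0 -val_eqE -?val_succZ.
Qed.

Lemma card_restr_compl (a b : label) e : (rank a < rank b)%N ->
  #|restr_compl q (shi_typeC m) (label_hyp a b e)| = #|configs a b e q [set: 'I_m]|.
Proof.
move=> ab.
have bij : bijective coords.
  exists (fun y : {ffun 'I_m -> 'I_q} => \row_k (y k : 'Z_q)) => [x|y].
    by apply/rowP=> k; rewrite mxE ffunE.
  by apply/ffunP=> k; rewrite ffunE mxE.
rewrite -(on_card_preimset (onW_bij _ bij)); congr #|pred_of_set _|.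
apply/setP=> x; rewrite [in RHS]inE; apply/idP/configsP => [|[V _]].
  rewrite inE mem_bigcup_seq => /andP[/hasP nK xH].
  split=> [c d f _ _ cd|k]; last by rewrite inE.
  rewrite -mem_hyp_mod -label_hyp_eq //.
  case: (eqVneq (label_hyp c d f) (label_hyp a b e)) => [->//|ne].
  apply/negP => xK; apply: nK; exists (label_hyp c d f); last by rewrite ne.
  by apply/mem_shi_typeC; exists c, d, f.
have V' c d f (cd : (rank c < rank d)%N) := V c d f (in_setT _) (in_setT _) cd.
rewrite inE mem_hyp_mod V' // -label_hyp_eq // eqxx andbT mem_bigcup_seq; apply/hasP=> -[K].
case/mem_shi_typeC=> [c [d [f [cd ->]]]] /andP[ne].
by rewrite mem_hyp_mod V' // -label_hyp_eq // (negbTE ne).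
Qed.
End Mod.
End Bridge.

(** * The cardinalities *)

Local Open Scope ring_scope.

(* Identities between products of integers whose factors are images of naturals
   or powers; the powers are opaque to the ring normalizer. *)
Ltac posz_ring :=
  rewrite ?PoszD -?[Posz 0]/(0 : int) -?[Posz 1]/(1 : int) -?[Posz 2]/(2 : int);
  repeat move: (_ ^+ _) => ?; ring.

(* Ordinals count from 0: the coordinates of index i, j : 'I_m are the
   coordinates i1 = i + 1 and j1 = j + 1 in the usual numbering. *)
Theorem theorem1p6 (m : nat) (hm : (0 < m)%N) (i j : 'I_m) (hij : (i < j)%N) :
  exists q0 : nat, forall q : nat, (0 < q)%N -> (q0 <= q)%N ->
  let T : int := q%:Z - 2 * m%:Z in
  let i1 : nat := i.+1 in
  let j1 : nat := j.+1 in
  let cardM (H : hyperplane m) : int := #|restr_compl q (shi_typeC m) H|%:Z in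
  [/\ cardM (hyp_double i 0)
        = (if odd q then T ^+ (m - i1) * (T + 1) ^+ (i1 - 1)
           else 2 * T ^+ (m - i1) * (T + 1) ^+ (i1 - 1)),
      cardM (hyp_double i 1)
        = (if odd q then T ^+ (i1 - 1) * (T + 1) ^+ (m - i1) else 0),
      cardM (hyp_sub i j 0)
        = (T + 1) ^+ (j1 - i1 - 1) * (T + 2) ^+ (m - j1 + i1),
      cardM (hyp_sub i j 1)
        = T ^+ (m - j1 + i1) * (T + 1) ^+ (j1 - i1 - 1)
    & cardM (hyp_add i j 0)
        = (if odd q then
             T ^+ (m - j1) * (T + 1) ^+ (j1 - i1) * (T + 2) ^+ (i1 - 1)
           else T ^+ (m - j1) * (T + 1) ^+ (j1 - i1 - 1) * (T + 2) ^+ i1)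
      /\ cardM (hyp_add i j 1)
        = (if odd q then
             T ^+ (i1 - 1) * (T + 1) ^+ (j1 - i1) * (T + 2) ^+ (m - j1)
           else T ^+ i1 * (T + 1) ^+ (j1 - i1 - 1) * (T + 2) ^+ (m - j1))].
Proof.
(* The bound makes T positive, which keeps the lists of residues in the counts of
   the special labels free of repetitions, and it makes 'Z_q the ring Z/qZ. *)
exists m.*2.+1 => q _ qT T i1 j1 cardM.
have im := ltn_ord i; have jm := ltn_ord j.
pose t := (q - m.*2)%N.
have t0 : (0 < t)%N by rewrite /t; lia.
have qE : q = (m.*2 + t)%N by rewrite /t; lia.
have TE : T = t%:Z by rewrite /T /t; lia.
have oq : odd q = odd t by rewrite qE oddD odd_double.
have cardE a b e : (rank a < rank b)%N ->
    #|restr_compl q (shi_typeC m) (label_hyp a b e)| = #|configs a b e (m.*2 + t) [set: 'I_m]|.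
  rewrite -qE => ab; case: q qT {t t0 qE T TE oq cardM} => [|[|n]] qT; try lia.
  exact: card_restr_compl.
have ri : (rank (i, false) < rank (i, true))%N by rewrite /rank /=; lia.
have rij s : (rank (i, false) < rank (j, s))%N by rewrite /rank /=; case: s; lia.
have ji : (j1 - i1 = (j - i.+1).+1)%N by rewrite /j1 /i1; lia.
rewrite /cardM TE oq ji !subn1 /= /i1 /j1.
rewrite (hyp_double_label i false) (hyp_double_label i true).
rewrite (hyp_sub_label i j false) (hyp_sub_label i j true).
rewrite (hyp_add_label i j false) (hyp_add_label i j true).
have PoszX a n : (a ^ n)%N%:Z = a%:Z ^+ n.
  by elim: n => // n IH; rewrite expnS exprS PoszM IH.
split; [| | | |split].
- rewrite (cardE _ _ _ ri) (card_full_double i _ t0) /= !PoszM !PoszX -[t.+1]addn1 PoszD.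
  by case: (odd t); posz_ring.
- rewrite (cardE _ _ _ ri) (card_full_double i _ t0) /= !PoszM !PoszX -[t.+1]addn1 PoszD.
  by case: (odd t); posz_ring.
- rewrite (cardE _ _ _ (rij _)) (card_full_sub0 hij t0) !PoszM !PoszX !PoszD exprD exprS.
  by posz_ring.
- rewrite (cardE _ _ _ (rij _)) (card_full_sub1 hij t0) !PoszM !PoszX !PoszD exprD exprS.
  by posz_ring.
- rewrite (cardE _ _ _ (rij _)) (card_full_add0 hij t0) !PoszM !PoszX !PoszD !exprS.
  by case: (odd t); posz_ring.
- rewrite (cardE _ _ _ (rij _)) (card_full_add1 hij t0) !PoszM !PoszX !PoszD !exprS.
  by case: (odd t); posz_ring.
Qed.
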